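(* Let $d\ge 2$, let $\sigma_1,\dots,\sigma_d>0$ and $\Sigma=\operatorname{diag}(\sigma_1^2,\dots,\sigma_d^2)$, let $\nu>0$, let $P$ be a $d\times d$ permutation matrix, and let $X\in\mathbb{R}^d$. For $l\in\mathbb{R}^{d(d-1)/2}$ let $L=L(l)$ be the strictly lower-triangular $d\times d$ matrix whose strictly lower-triangular entries are the components of $l$, and set $$\Theta(l)=(I-PLP^\top)^\top\,\Sigma^{-1}\,(I-PLP^\top).$$ Define the marginal likelihood $$p(X\mid \Sigma,\nu,P)=\int_{\mathbb{R}^{d(d-1)/2}} \mathcal{N}\big(X;0,\Theta(l)^{-1}\big)\,\mathcal{N}\big(l;0,\nu^2 I\big)\,dl ,$$ where $\mathcal{N}(\cdot\,;0,C)$ denotes the centered Gaussian density with covariance $C$. Let $G$ be the $d\times d$ strictly lower-triangular matrix with all strictly lower-triangular entries equal to $1$, let $X^2$ denote the entrywise square of $X$, and let $D=\operatorname{diag}(PGP^\top X^2)$ (the diagonal matrix whose diagonal is the vector $PGP^\top X^2$). Suppose $D$ has exactly one zero diagonal entry, at index $i$ (this holds for almost every $X$). Let $\Sigma',D'\in\mathbb{R}^{(d-1)\times(d-1)}$ be obtained from $\Sigma,D$ by deleting the $i$th row and column, and let $S$ be the $d\times d$ diagonal matrix with $S_{jj}=\dfrac{\nu^2 D_{jj}}{\sigma_j^2(\sigma_j^2+\nu^2D_{jj})}$. Then $$\log p(X\mid\Sigma,\nu,P) = -\frac d2\log 2\pi-\sum_{j=1}^d\log\sigma_j-(d-1)\log\nu+\frac12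 X^\top(S-\Sigma^{-1})X-\frac12\log\det D'-\frac12\log\det\big(\Sigma'^{-1}+\nu^{-2}D'^{-1}\big).$$
   Context: This is the marginal likelihood of a single observation $X$ from a linear-Gaussian structural equation model $X=W^\top X+\epsilon$, $\epsilon\sim\mathcal{N}(0,\Sigma)$, with $W^\top=PLP^\top$ (a DAG adjacency matrix written via a permutation $P$ and strictly lower-triangular weight matrix $L$), after integrating out the edge weights $l$ under an isotropic Gaussian prior $\mathcal{N}(0,\nu^2 I)$. Note $\det(I-PLP^\top)=1$, so $\det\Theta(l)=\det\Sigma^{-1}$. *)

(* Defs.v *)
From HB Require Import structures.
From mathcomp Require Import all_boot all_order all_algebra.
From mathcomp Require Import all_classical all_reals all_analysis.
Set Implicit Arguments. Unset Strict Implicit. Unset Printing Implicit Defensive.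
Import Order.TTheory GRing.Theory Num.Theory.
Local Open Scope ring_scope.

Section Defs.
Variable R : realType.

(* Iterated Lebesgue integral over R^n (n.-tuple R), in \bar R.
   For the nonnegative integrands used below this is the Lebesgue integral
   over R^n (Tonelli). *)
Fixpoint iint (n : nat) : (n.-tuple R -> \bar R) -> \bar R :=
  match n return (n.-tuple R -> \bar R) -> \bar R with
  | 0 => fun f => f [tuple]
  | n'.+1 => fun f =>
      (\int[@lebesgue_measure R]_(x in [set: R]) iint (fun t => f (cons_tuple x t)))%E
  end.

Definition gauss_dens (n : nat) (C : 'M[R]_n) (x : 'cV[R]_n) : R :=
  (Num.sqrt ((pi *+ 2) ^+ n * \det C))^-1
  * expR (- (1/2) * (x^T *m invmx C *m x) ord0 ord0).

Definition lowpairs (d : nat) : seq ('I_d * 'I_d) :=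
  [seq p <- [seq (a, b) | a <- enum 'I_d, b <- enum 'I_d] | (val p.2 < val p.1)%N].

Definition lowmx (d : nat) (l : seq R) : 'M[R]_d :=
  \matrix_(a, b) if (b < a)%N then nth 0 l (index (a, b) (lowpairs d)) else 0.

Definition Sigmamx (d : nat) (sigma : 'I_d -> R) : 'M[R]_d :=
  diag_mx (\row_j (sigma j ^+ 2)).

Definition Theta (d : nat) (sigma : 'I_d -> R) (P : 'M[R]_d) (l : seq R) : 'M[R]_d :=
  (1%:M - P *m lowmx d l *m P^T)^T *m invmx (Sigmamx sigma)
    *m (1%:M - P *m lowmx d l *m P^T).

Definition ldim (d : nat) : nat := (d * d.-1)./2.

Definition tcol (m : nat) (l : m.-tuple R) : 'cV[R]_m := \col_i tnth l i.

Definition marglik (d : nat) (sigma : 'I_d -> R) (nu : R) (P : 'M[R]_d)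
    (X : 'cV[R]_d) : \bar R :=
  iint (fun l : (ldim d).-tuple R =>
    (gauss_dens (invmx (Theta sigma P l)) X
     * gauss_dens (nu ^+ 2 *: (1%:M : 'M[R]_(ldim d))) (tcol l))%:E).

Definition Gmx (d : nat) : 'M[R]_d := \matrix_(a, b) (if (b < a)%N then 1 else 0).

Definition Dmx (d : nat) (P : 'M[R]_d) (X : 'cV[R]_d) : 'M[R]_d :=
  diag_mx (P *m Gmx d *m P^T *m map_mx (fun x => x ^+ 2) X)^T.

Definition Smx (d : nat) (sigma : 'I_d -> R) (nu : R) (D : 'M[R]_d) : 'M[R]_d :=
  diag_mx (\row_j (nu ^+ 2 * D j j / (sigma j ^+ 2 * (sigma j ^+ 2 + nu ^+ 2 * D j j)))).

Definition delrc (d : nat) (i : 'I_d) (A : 'M[R]_d) : 'M[R]_(d.-1) :=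
  row' i (col' i A).

End Defs.

(* Main.v *)
(* Row a of X - P L P^T X is affine in the entries of row a of P L P^T, and
   distinct rows involve disjoint sets of edge weights, so the integrand is a
   product of one-dimensional Gaussian densities. Integrating out a weight that
   multiplies X_b convolves two Gaussians, which adds nu^2 X_b^2 to the variance
   of its row. Hence p(X) is the product over a of the densities
   N(X_a; 0, sigma_a^2 + nu^2 D_aa), and the stated formula is its logarithm,
   the factor a = i having variance sigma_i^2. *)
Require Import Defs.
From HB Require Import structures.
From mathcomp Require Import all_boot all_order all_algebra.
From mathcomp Require Import all_classical all_reals all_analysis.
From mathcomp Require Import fingroup perm.
From mathcomp Require Import ring lra.
Import Order.TTheory GRing.Theory Num.Theory.
Local Open Scope ring_scope.

(** * One-dimensional Gaussian densities and iterated integrals of their products *)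

Section Gauss1.
Set Implicit Arguments. Unset Strict Implicit.
Variable R : realType.
Implicit Types (v c x y : R).

(** For [0 < v], the centered normal density of variance [v] (not standard deviation). As a single
    exponential it turns products into sums of exponents. *)
Definition gauss1 v x : R :=
  expR (- (1/2) * ln (pi *+ 2) - (1/2) * ln v - x ^+ 2 / (v *+ 2)).

Lemma pi2_gt0 : 0 < pi *+ 2 :> R.
Proof. by rewrite pmulrn_lgt0// pi_gt0. Qed.

Lemma invsqrtE v : 0 < v -> (Num.sqrt v)^-1 = expR (- (1/2) * ln v).
Proof.
move=> v0; rewrite -[v in LHS]lnK ?posrE//.
have -> : ln v = (1/2 * ln v) *+ 2 by rewrite mulr2n; field.
rewrite -mulr_natl expRM_natl sqrtr_sqr ger0_norm ?expR_ge0// -expRN.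
by congr expR; field.
Qed.

(** Link to the library density, which is parametrized by the standard deviation and is known to
    have total mass one. *)
Lemma normal_pdf_gauss1 (m s x : R) : 0 < s ->
  normal_pdf m s x = gauss1 (s ^+ 2) (x - m).
Proof.
move=> s0; rewrite normal_pdfE ?gt_eqF// /normal_peak /normal_fun /gauss1.
have s20 : 0 < s ^+ 2 by rewrite exprn_gt0.
rewrite -mulrnAr invsqrtE ?mulr_gt0 ?pi2_gt0// lnM ?posrE ?pi2_gt0//.
by rewrite -expRD; congr expR; lra.
Qed.

(** Completing the square in [y] factors the integrand into the density of [c] with variance [w] and
    a normal density in [y], which integrates to one. *)
Lemma gauss1_conv (K nu v c x : R) : 0 <= K -> 0 < nu -> 0 < v ->
  (\int[@lebesgue_measure R]_(y in [set: R])
     (K * (gauss1 (nu ^+ 2) y * gauss1 v (c - y * x)))%:E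
   = (K * gauss1 (v + nu ^+ 2 * x ^+ 2) c)%:E)%E.
Proof.
move=> K0 nu0 v0.
have nu20 : 0 < nu ^+ 2 by rewrite exprn_gt0.
set w := v + _.
have w0 : 0 < w by rewrite ltr_wpDr// mulr_ge0 ?sqr_ge0.
(* [m] and [s] are the posterior mean and standard deviation of the weight [y] given [c]. *)
pose s := Num.sqrt (nu ^+ 2 * v / w).
have s20 : 0 < nu ^+ 2 * v / w by rewrite divr_gt0 ?mulr_gt0.
have s0 : 0 < s by rewrite sqrtr_gt0.
pose m := nu ^+ 2 * x * c / w.
have E y : K * (gauss1 (nu ^+ 2) y * gauss1 v (c - y * x))
         = (K * gauss1 w c) * normal_pdf m s y.
  rewrite normal_pdf_gauss1// -mulrA; congr (K * _).
  rewrite /gauss1 -!expRD; congr expR.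
  rewrite sqr_sqrtr ?ltW// lnM ?posrE ?mulr_gt0 ?invr_gt0//.
  rewrite lnM ?posrE// lnV ?posrE//.
  (* The logarithms of the variances cancel, since the product of [w] and [s ^+ 2] is [nu ^+ 2 * v];
     only the quadratic parts remain. *)
  suff H : - (y ^+ 2 / (nu ^+ 2 *+ 2)) - (c - y * x) ^+ 2 / (v *+ 2)
     = - (c ^+ 2 / (w *+ 2)) - (y - m) ^+ 2 / ((nu ^+ 2 * v / w) *+ 2) by lra.
  rewrite /m /w; field.
  by rewrite exprMn -/w !gt_eqF.
under eq_integral do rewrite E EFinM.
have gK : 0 <= K * gauss1 w c by rewrite mulr_ge0 ?expR_ge0.
rewrite ge0_integralZl_EFin//=.
- by rewrite integral_normal_pdf mule1.
- by move=> y _; rewrite lee_fin normal_pdf_ge0.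
- by apply/measurable_realfun.measurable_EFinP; exact: measurable_normal_pdf.
Qed.

(* [r k] is the row to which the variable of integration [tnth l k] belongs. *)
Lemma iint_gauss (I : finType) (nu : R) (v : I -> R) n :
  0 < nu -> (forall a, 0 < v a) ->
  forall (K : R) (c : I -> R) (r : 'I_n -> I) (x : 'I_n -> R), 0 <= K ->
  iint (fun l : n.-tuple R =>
    (K * ((\prod_a gauss1 (v a) (c a - \sum_(k | r k == a) tnth l k * x k))
          * \prod_k gauss1 (nu ^+ 2) (tnth l k)))%:E)
  = (K * \prod_a gauss1 (v a + nu ^+ 2 * \sum_(k | r k == a) x k ^+ 2) (c a))%:E.
Proof.
(* [K] and [c] vary in the induction: for a fixed outermost variable [y], its prior density is
   absorbed into [K] and its shift [y * x ord0] into [c]. *)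
move=> nu0 v0; elim: n => [|n IHn] K c r x K0 /=.
  rewrite big_ord0 mulr1; congr (K * _)%:E; apply: eq_bigr => a _.
  by rewrite !big_ord0 mulr0 addr0 subr0.
pose x' k := x (lift ord0 k); pose r' k := r (lift ord0 k).
pose c' y a := c a - (if r ord0 == a then y * x ord0 else 0).
pose w a := v a + nu ^+ 2 * \sum_(k | r' k == a) x' k ^+ 2.
have w0 a : 0 < w a.
  rewrite ltr_wpDr// mulr_ge0 ?sqr_ge0// sumr_ge0// => k _.
  exact: sqr_ge0.
(* After the inner integrals only the factor of row [r ord0] still contains the likelihood shift by
   [y]; the other rows are constant and collected here. *)
pose K' := K * \prod_(a | a != r ord0) gauss1 (w a) (c a).
have K'0 : 0 <= K' by rewrite mulr_ge0// prodr_ge0// => a _; exact: expR_ge0.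
transitivity (\int[@lebesgue_measure R]_(y in [set: R])
   (K' * (gauss1 (nu ^+ 2) y
          * gauss1 (w (r ord0)) (c (r ord0) - y * x ord0)))%:E)%E.
  apply: eq_integral => y _.
  transitivity (iint (fun t : n.-tuple R => (K * gauss1 (nu ^+ 2) y *
     ((\prod_a gauss1 (v a) (c' y a - \sum_(k | r' k == a) tnth t k * x' k))
          * \prod_k gauss1 (nu ^+ 2) (tnth t k)))%:E)).
    congr iint; apply/funext => t; congr EFin.
    rewrite big_ord_recl tnth0 -!mulrA; congr (K * _).
    rewrite mulrCA; congr (_ * (_ * _)).
      apply: eq_bigr => a _; congr (gauss1 _ _).
      rewrite /c' -addrA -opprD big_mkcond big_ord_recl tnth0 -big_mkcond/=.
      by congr (_ - (_ + _)); apply: eq_bigr => k _; rewrite tnthS.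
    by apply: eq_bigr => k _; rewrite tnthS.
  rewrite IHn ?mulr_ge0 ?expR_ge0//; congr EFin.
  rewrite (bigD1 (r ord0))//= /K' /c' eqxx.
  rewrite [in RHS]mulrAC !mulrA; congr (_ * _).
  by apply: eq_bigr => a; rewrite eq_sym => /negbTE ->; rewrite subr0.
rewrite gauss1_conv//; congr EFin.
have wE a : v a + nu ^+ 2 * \sum_(k | r k == a) x k ^+ 2
    = w a + (if r ord0 == a then nu ^+ 2 * x ord0 ^+ 2 else 0).
  rewrite /w -addrA big_mkcond big_ord_recl -big_mkcond/=.
  by case: ifP => _; rewrite ?add0r ?addr0// mulrDr [X in _ + X]addrC.
rewrite (eq_bigr _ (fun a _ => congr1 (gauss1^~ (c a)) (wE a))).
rewrite (bigD1 (r ord0))//= eqxx /K' -mulrA [X in _ * X]mulrC.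
congr (_ * (_ * _)); apply: eq_bigr => a.
by rewrite eq_sym => /negbTE ->; rewrite addr0.
Qed.

Lemma ln_prod (I : finType) (f : I -> R) : (forall i, 0 < f i) ->
  ln (\prod_i f i) = \sum_i ln (f i).
Proof.
move=> f0; rewrite (eq_bigr (fun i => expR (ln (f i)))) => [|i _].
  by rewrite -expR_sum expRK.
by rewrite lnK ?posrE.
Qed.

(** The density sees [C] only through its determinant and its quadratic form, so [C] need not be
    diagonal. This serves both the likelihood, with [y] the residuals, and the prior, with [y] the
    weights. *)
Lemma gauss_dens_prod n (C : 'M[R]_n) (x : 'cV[R]_n) (v y : 'I_n -> R) :
  (forall a, 0 < v a) -> \det C = \prod_a v a ->
  (x^T *m invmx C *m x) ord0 ord0 = \sum_a y a ^+ 2 / v a ->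
  gauss_dens C x = \prod_a gauss1 (v a) (y a).
Proof.
move=> v0 detC qC; rewrite /gauss_dens detC qC -expR_sum.
have Pv0 : 0 < \prod_a v a by rewrite prodr_gt0.
rewrite invsqrtE ?mulr_gt0 ?exprn_gt0 ?pi2_gt0// -expRD; congr expR.
rewrite lnM ?posrE ?exprn_gt0 ?pi2_gt0// lnXn ?pi2_gt0// ln_prod//.
rewrite !big_split/= sumr_const card_ord mulrDr mulrnAr.
rewrite -addrA -addrA; congr (_ + _).
rewrite !mulr_sumr -!big_split/=.
by apply: eq_bigr => a _; field; rewrite gt_eqF.
Qed.

End Gauss1.

(** * Diagonal matrices: inverse, quadratic form, deletion of an index *)

Section Diag.
Set Implicit Arguments. Unset Strict Implicit.

Lemma invmx_diag (F : fieldType) n (r : 'rV[F]_n) : (forall j, r 0 j != 0) ->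
  invmx (diag_mx r) = diag_mx (\row_j (r 0 j)^-1).
Proof.
move=> r0.
have E : diag_mx r *m diag_mx (\row_j (r 0 j)^-1) = 1%:M.
  apply/matrixP => a b; rewrite mul_diag_mx !mxE.
  by case: eqP => [->|_]; rewrite ?mulr0// mulfV.
have [u _] := mulmx1_unit E.
by rewrite -[LHS]mulmx1 -E mulKmx.
Qed.

Lemma diag_quad (A : comNzRingType) n (r : 'rV[A]_n) (x : 'cV[A]_n) :
  (x^T *m diag_mx r *m x) ord0 ord0 = \sum_a r 0 a * x a 0 ^+ 2.
Proof.
rewrite mxE; apply: eq_bigr => a _; rewrite mul_mx_diag !mxE.
by rewrite mulrAC mulrC expr2.
Qed.

Lemma delrc_diag (R : realType) d (i : 'I_d.+1) (r : 'rV[R]_d.+1) :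
  delrc i (diag_mx r) = diag_mx (\row_j r 0 (lift i j)).
Proof.
by apply/matrixP => a b; rewrite !mxE (inj_eq lift_inj).
Qed.

End Diag.

(** * Permuted strictly lower-triangular matrices and the marginal likelihood as a product *)

Section Low.
Set Implicit Arguments. Unset Strict Implicit.
Variable d : nat.

Lemma mem_lowpairs (p : 'I_d * 'I_d) : (p \in lowpairs d) = (p.2 < p.1)%N.
Proof.
rewrite mem_filter; case: ltnP => //= _; case: p => a b.
by apply/allpairsP; exists (a, b); rewrite !mem_enum.
Qed.

Lemma uniq_lowpairs : uniq (lowpairs d).
Proof.
rewrite filter_uniq// allpairs_uniq ?enum_uniq//.
by move=> [? ?] [? ?].
Qed.

Lemma size_lowpairs : size (lowpairs d) == ldim d.
Proof.
(* [ldim d] is the binomial coefficient of [d] over 2, the sum of all [a < d]; row [a] holds exactly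
   [a] pairs. *)
rewrite /ldim -bin2 -bin2_sum big_mkord -sum1_size.
rewrite (big_uniq _ uniq_lowpairs).
under eq_bigl do rewrite mem_lowpairs.
rewrite -(pair_big_dep xpredT (fun a b : 'I_d => (b < a)%N) (fun _ _ => 1%N))/=.
apply/eqP/eq_bigr => a _; rewrite (big_ord_narrow (ltnW (ltn_ord a))).
by rewrite sum1_card card_ord.
Qed.

(** Indexed like the integration variables: weight [k] sits at position [tnth lowtuple k] of [L]. *)
Definition lowtuple : (ldim d).-tuple ('I_d * 'I_d) := Tuple size_lowpairs.

Variable R : realType.

(** Conjugation by [perm_mx s] puts entry [(s a, s b)] of [L] at [(a, b)], so a weight at [p] acts
    in row [s^-1 p.1] on coordinate [s^-1 p.2]. This is the row-wise form required by
    [iint_gauss]. *)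
Lemma mulmx_perm_low (s : 'S_d) (l : (ldim d).-tuple R) (Y : 'cV[R]_d) a :
  (perm_mx s *m lowmx d l *m (perm_mx s)^T *m Y) a ord0 =
  \sum_(k | s^-1%g (tnth lowtuple k).1 == a)
     tnth l k * Y (s^-1%g (tnth lowtuple k).2) ord0.
Proof.
rewrite tr_perm_mx -!mulmxA -!row_permE !mxE.
pose F (p : 'I_d * 'I_d) := nth 0 l (index p (lowpairs d)) * Y (s^-1%g p.2) ord0.
transitivity (\sum_(p <- lowtuple | s^-1%g p.1 == a) F p).
  rewrite [RHS]big_mkcond [RHS](big_uniq _ uniq_lowpairs) -big_mkcondr.
  under [RHS]eq_bigl => p do rewrite mem_lowpairs andbC.
  rewrite -(pair_big_dep (fun c => s^-1%g c == a) (fun c b : 'I_d => (b < c)%N)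
              (fun c b => F (c, b))).
  rewrite [RHS](big_pred1 (s a)) => [|c]; last exact: (canF_eq (permKV s)).
  rewrite [RHS]big_mkcond; apply: eq_bigr => b _; rewrite !mxE.
  by case: ifP => _; rewrite ?mul0r.
rewrite big_tuple; apply: eq_bigr => k _; rewrite /F.
congr (_ * _); rewrite (tnth_nth 0) (tnth_nth (tnth lowtuple k)).
by rewrite index_uniq ?uniq_lowpairs// (eqP size_lowpairs).
Qed.

(** Since [P P^T = 1], the matrix is the conjugate [P (1 - L) P^T] of a unitriangular one. *)
Lemma det_perm_low (s : 'S_d) (l : seq R) :
  \det (1%:M - perm_mx s *m lowmx d l *m (perm_mx s)^T) = 1.
Proof.
have PP : perm_mx s *m (perm_mx s)^T = 1%:M :> 'M[R]_d.
  by rewrite tr_perm_mx -perm_mxM mulgV perm_mx1.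
rewrite -[X in X - _]PP -[X in X *m _ - _]mulmx1 -mulmxBl -mulmxBr.
rewrite !det_mulmx mulrAC -det_mulmx PP det1 mul1r det_trig.
  by rewrite big1// => a _; rewrite !mxE eqxx ltnn subr0.
apply/is_trig_mxP => a b ab; rewrite !mxE.
by rewrite ltnNge (ltnW ab) subr0 -val_eqE (ltn_eqF ab).
Qed.

(** With [M = 1 - P L P^T] of determinant one, the covariance has the determinant of [Sigma], and
    the quadratic form is that of [Sigma^-1] at the residual [M X]. *)
Lemma gauss_dens_Theta (sigma : 'I_d -> R) (s : 'S_d) (l : seq R)
    (X : 'cV[R]_d) : (forall j, 0 < sigma j) ->
  gauss_dens (invmx (Theta sigma (perm_mx s) l)) X =
  \prod_a gauss1 (sigma a ^+ 2)
    (((1%:M - perm_mx s *m lowmx d l *m (perm_mx s)^T) *m X) a ord0).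
Proof.
move=> sigma0; have s20 a : 0 < sigma a ^+ 2 by rewrite exprn_gt0.
apply: gauss_dens_prod => //.
  rewrite /Theta det_inv !det_mulmx det_tr !det_perm_low mul1r mulr1 det_inv.
  by rewrite invrK det_diag; apply: eq_bigr => a _; rewrite mxE.
rewrite invmxK /Theta; set M := 1%:M - _.
rewrite -!mulmxA mulmxA -trmx_mul mulmxA.
rewrite invmx_diag => [|a]; last by rewrite mxE gt_eqF.
rewrite diag_quad; apply: eq_bigr => a _.
by rewrite [X in X * _]mxE mxE mulrC.
Qed.

(** [G] is [L] with unit weights, so [mulmx_perm_low] also computes [D]. *)
Lemma Gmx_low : Gmx R d = lowmx d [tuple of nseq (ldim d) 1].
Proof.
apply/matrixP => a b; rewrite !mxE; case: ifP => // ab.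
by rewrite nth_nseq -(eqP size_lowpairs) index_mem mem_lowpairs ab.
Qed.

(** Identifies [D] with the sum of squares that [iint_gauss] adds to the variance of row [a]; it
    also shows [D] to be nonnegative. *)
Lemma DmxE (s : 'S_d) (X : 'cV[R]_d) a :
  Dmx (perm_mx s) X a a = \sum_(k | s^-1%g (tnth lowtuple k).1 == a)
     X (s^-1%g (tnth lowtuple k).2) ord0 ^+ 2.
Proof.
rewrite mxE eqxx mulr1n mxE Gmx_low mulmx_perm_low.
by apply: eq_bigr => k _; rewrite mxE (tnth_nth 0) nth_nseq ltn_ord mul1r.
Qed.

Lemma marglik_prod (sigma : 'I_d -> R) (nu : R) (s : 'S_d) (X : 'cV[R]_d) :
  (forall j, 0 < sigma j) -> 0 < nu ->
  marglik sigma nu (perm_mx s) X =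
  (\prod_a gauss1 (sigma a ^+ 2 + nu ^+ 2 * Dmx (perm_mx s) X a a) (X a ord0))%:E.
Proof.
move=> sigma0 nu0; have s20 a : 0 < sigma a ^+ 2 by rewrite exprn_gt0.
have := @iint_gauss R _ nu (fun a => sigma a ^+ 2) (ldim d) nu0 s20 1
  (fun a => X a ord0) (fun k => s^-1%g (tnth lowtuple k).1)
  (fun k => X (s^-1%g (tnth lowtuple k).2) ord0) ler01.
rewrite mul1r => E.
under eq_bigr do rewrite DmxE.
rewrite -E /marglik; congr iint; apply/funext => l; congr EFin.
rewrite mul1r gauss_dens_Theta//; congr (_ * _).
  apply: eq_bigr => a _; congr gauss1.
  by rewrite mulmxBl mul1mx [LHS]mxE [X in _ + X]mxE mulmx_perm_low.
apply: gauss_dens_prod => [a||].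
- by rewrite exprn_gt0.
- by rewrite scalemx1 det_scalar prodr_const card_ord.
- rewrite scalemx1 invmx_scalar -diag_const_mx diag_quad.
  by apply: eq_bigr => k _; rewrite !mxE mulrC.
Qed.

End Low.

Theorem theorem1 (R : realType) (d : nat) (sigma : 'I_d -> R) (nu : R)
    (P : 'M[R]_d) (X : 'cV[R]_d) (i : 'I_d) :
  (2 <= d)%N ->
  (forall j, 0 < sigma j) ->
  0 < nu ->
  is_perm_mx P ->
  Dmx P X i i = 0 ->
  (forall j, j != i -> Dmx P X j j != 0) ->
  marglik sigma nu P X =
  (expR (- (d%:R / 2) * ln (pi *+ 2)
         - \sum_(j < d) ln (sigma j)
         - (d.-1)%:R * ln nu
         + (1/2) * (X^T *m (Smx sigma nu (Dmx P X) - invmx (Sigmamx sigma)) *m X) ord0 ord0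
         - (1/2) * ln (\det (delrc i (Dmx P X)))
         - (1/2) * ln (\det (invmx (delrc i (Sigmamx sigma))
                             + nu ^-2 *: invmx (delrc i (Dmx P X))))))%:E.
Proof.
move=> d2 sigma0 nu0 /is_perm_mxP[s ->] {P d2} Di0 Dj0.
rewrite marglik_prod//; congr EFin.
case: d => [|d'] in sigma X i s sigma0 Di0 Dj0 *; first by case: (i).
have s20 a : 0 < sigma a ^+ 2 by rewrite exprn_gt0.
have nu20 : 0 < nu ^+ 2 by rewrite exprn_gt0.
set D := Dmx (perm_mx s) X in Di0 Dj0 *.
have [r Dr] : exists r, D = diag_mx r by rewrite /D /Dmx; eexists.
have Da a : D a a = r 0 a by rewrite Dr mxE eqxx.
have D_ge0 a : 0 <= r 0 a.
  by rewrite -Da /D DmxE sumr_ge0// => k _; exact: sqr_ge0.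
clearbody D.
(* Sums of squares that are nonzero away from [i] are positive there, so logarithms of products can
   be split. *)
have Dl0 j : 0 < r 0 (lift i j).
  by rewrite lt_neqAle D_ge0 eq_sym -Da Dj0// eq_sym neq_lift.
have w0 a : 0 < sigma a ^+ 2 + nu ^+ 2 * r 0 a.
  by rewrite ltr_wpDr// mulr_ge0// ltW.
rewrite -expR_sum; congr expR.
rewrite [in ln (\det (delrc i D))]Dr [in ln (\det (_ + _))]Dr /Sigmamx.
rewrite !delrc_diag !invmx_diag; last 3 first.
- by move=> j; rewrite !mxE gt_eqF.
- by move=> j; rewrite !mxE gt_eqF.
- by move=> j; rewrite !mxE gt_eqF.
rewrite /Smx -linearB/= diag_quad -linearZ -linearD/= !det_diag.
rewrite !ln_prod; last 2 first.
- by move=> j; rewrite !mxE addr_gt0// ?mulr_gt0// invr_gt0.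
- by move=> j; rewrite !mxE.
pose W a := sigma a ^+ 2 + nu ^+ 2 * r 0 a.
(* The two determinants come from here: [W i] is [sigma i ^+ 2], and every other [W a] factors as
   [sigma^2 nu^2 D (sigma^-2 + nu^-2 D^-1)]. *)
have lnW : \sum_a ln (W a) = 2 * (\sum_a ln (sigma a)) + 2 * d'%:R * ln nu
   + \sum_j ln (r 0 (lift i j))
   + \sum_j ln ((sigma (lift i j) ^+ 2)^-1 + nu ^- 2 * (r 0 (lift i j))^-1).
  rewrite (bigD1_ord i)//= [in RHS](bigD1_ord i)//=.
  rewrite {1}/W -Da Di0 mulr0 addr0 lnXn// -[X in X + _]mulr_natl.
  have -> : 2 * d'%:R * ln nu = \sum_(j < d') (2 * ln nu).
    by rewrite sumr_const card_ord -mulr_natl; ring.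
  rewrite mulrDr -!addrA; congr (_ + _).
  rewrite mulr_sumr -!big_split/=; apply: eq_bigr => j _.
  set a := lift i j.
  have -> : W a = (sigma a) ^+ 2 * (nu ^+ 2 * (r 0 a
      * ((sigma a ^+ 2)^-1 + nu ^- 2 * (r 0 a)^-1))).
    by rewrite /W; field; rewrite !gt_eqF// Dl0.
  have q0 : 0 < (sigma a ^+ 2)^-1 + nu ^- 2 * (r 0 a)^-1.
    by rewrite addr_gt0 ?mulr_gt0 ?invr_gt0// Dl0.
  have ra0 : 0 < r 0 a by exact: Dl0.
  rewrite lnM ?posrE ?mulr_gt0// lnXn// -[_ *+ 2]mulr_natl; congr (_ + _).
  rewrite lnM ?posrE ?mulr_gt0// lnXn// -[_ *+ 2]mulr_natl; congr (_ + _).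
  by rewrite lnM ?posrE.
have -> : \sum_(i0 < d') ln ((\row_j r 0 (lift i j)) 0 i0) = \sum_j ln (r 0 (lift i j)).
  by apply: eq_bigr => j _; rewrite mxE.
set S5 := (X in _ = _ - (1/2) * X).
have -> : S5 = \sum_j ln ((sigma (lift i j) ^+ 2)^-1 + nu ^- 2 * (r 0 (lift i j))^-1).
  by apply: eq_bigr => j _; rewrite !mxE.
set S4 := (X in _ + (1/2) * X - _ - _).
(* The diagonal entries of [S - Sigma^-1] simplify to [- 1 / W a]. *)
have -> : S4 = - \sum_a X a 0 ^+ 2 / W a.
  rewrite -sumrN; apply: eq_bigr => a _; rewrite !mxE Da /W.
  by field; rewrite !gt_eqF.
(* Each exponent is split into constant, log-variance and quadratic parts; their sums match the
   terms of the goal through [lnW]. *)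
rewrite (eq_bigr (fun a => - (1/2) * ln (pi *+ 2) + (- (1/2) * ln (W a)
     - (1/2) * (X a ord0 ^+ 2 / W a)))); last first.
  by move=> a _; rewrite Da -/(W a); field; rewrite gt_eqF// w0.
rewrite !big_split/= sumr_const card_ord sumrN -!mulr_sumr lnW /= -mulr_natl.
by field.
Qed.
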